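(* Let $H_0$, $H_1$ be two $(N-1)\times(N-1)$ Jacobi matrices with the same off-diagonal coefficients $a_0=a_1=a$, $a(n)<0$, and with real diagonal coefficients $b_0(n)$, respectively $b_1(n)$. Let $s_{j,\pm}(z,\cdot)$, $j=0,1$, be the corresponding solutions of the underlying difference equations defined in the context. Then for $\lambda_0,\lambda_1\in\mathbb{R}$ the number of weighted nodes of the Wronskian $W(s_{0,-}(\lambda_0),s_{1,+}(\lambda_1))$ equals the number of eigenvalues of $H_1$ below $\lambda_1$ minus the number of eigenvalues of $H_0$ below or equal to $\lambda_0$, and the same holds for $W(s_{0,+}(\lambda_0),s_{1,-}(\lambda_1))$: $$\#(s_{0,-}(\lambda_0),s_{1,+}(\lambda_1)) = \#(s_{0,+}(\lambda_0),s_{1,-}(\lambda_1)) = \#\{E\in\sigma(H_1)\mid E<\lambda_1\}-\#\{E\in\sigma(H_0)\mid E\le\lambda_0\},$$ where $\#(\cdot,\cdot)$ is the number of weighted nodes of the Wronskian between $0$ and $N$ (defined in the context), $\sigma(H)$ denotes the spectrum of $H$, that is, the set of eigenvalues, and $\#\{\dots\}$ denotes the cardinality of a set.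
   Context: Let $N\ge2$ be an integer. For $j=0,1$, $H_j$ is the real symmetric tridiagonal $(N-1)\times(N-1)$ matrix, acting in $\mathbb{C}^{N-1}$, with diagonal entries $b_j(1),\dots,b_j(N-1)\in\mathbb{R}$ and off-diagonal entries $(H_j)_{n,n+1}=(H_j)_{n+1,n}=a(n)<0$, $n=1,\dots,N-2$ (the same $a$ for $j=0,1$). Set in addition $a(0)=a(N-1)=a(N)=-1$ and $b_0(N)=b_1(N)=0$. For $z\in\mathbb{C}$, a solution of the difference equation associated with $H_j$ at $z$ is a sequence $u(0),u(1),\dots,u(N+1)$ with $$a(n)u(n+1)+b_j(n)u(n)+a(n-1)u(n-1)=z\,u(n),\qquad n=1,\dots,N.$$ $s_{j,-}(z,\cdot)$ is the solution with $s_{j,-}(z,0)=0$, $s_{j,-}(z,1)=1$; $s_{j,+}(z,\cdot)$ is the solution with $s_{j,+}(z,N)=0$, $s_{j,+}(z,N+1)=1$. We write $s_{j,\pm}(\lambda)$ for the sequence $s_{j,\pm}(\lambda,\cdot)$. Given two solutions $u_j$ of the difference equations associated with $H_j$, $j=0,1$, their Wronskian is $$W_n(u_0,u_1)=a(n)\big(u_0(n)u_1(n+1)-u_0(n+1)u_1(n)\big),\qquad n=0,\dots,N.$$ For $n=0,\dots,N-1$ the weight $\#_n(u_0,u_1)$ is defined, writing $W_n=W_n(u_0,u_1)$, by: - $\#_n(u_0,u_1)=1$ if $b_0(n+1)-b_1(n+1)>0$ and either $W_nW_{n+1}<0$, or $W_n=0$ and $W_{n+1}\ne0$; - $\#_n(u_0,u_1)=-1$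 if $b_0(n+1)-b_1(n+1)<0$ and either $W_nW_{n+1}<0$, or $W_n\neq0$ and $W_{n+1}=0$; - $\#_n(u_0,u_1)=0$ otherwise. The Wronskian has a weighted node at $n$ if $\#_n(u_0,u_1)\ne0$. The number of weighted nodes of the Wronskian between $0$ and $N$ is $$\#(u_0,u_1)=\sum_{n=0}^{N-1}\#_n(u_0,u_1)-\begin{cases}0,&W_0(u_0,u_1)\ne0,\\1,&W_0(u_0,u_1)=0.\end{cases}$$
   Formalization: The weights #_n are taken with the sign of (b_0(n+1)-λ_0)-(b_1(n+1)-λ_1) instead of b_0(n+1)-b_1(n+1); the two agree when λ_0=λ_1, and the literal claim fails otherwise (N=2, b_0=b_1=0, λ_0=-1, λ_1=1). *)

(* Defs.v *)
From HB Require Import structures.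
From mathcomp Require Import all_boot all_order all_algebra.
From mathcomp Require Import finmap complex.
From mathcomp Require Import boolp classical_sets functions cardinality reals.
From mathcomp Require Import zify ring.

Set Implicit Arguments.
Unset Strict Implicit.
Unset Printing Implicit Defensive.

Import Order.TTheory GRing.Theory Num.Theory.

Local Open Scope classical_set_scope.
Local Open Scope ring_scope.
Local Open Scope complex_scope.

(* Sequences a(n), b(n), u(n) are functions on nat of which only the values at
   n <= N + 1 matter.  Rows and columns of the matrix are numbered from 0 in
   'I_(N.-1) and from 1 on paper, hence the successors. *)
Definition jacobi_matrix (R : nzRingType) (N : nat) (a b : nat -> R) :
    'M[R]_(N.-1) :=
  \matrix_(i < N.-1, j < N.-1)
    if i == j :> nat then b i.+1
    else if j == i.+1 :> nat then a i.+1
    else if i == j.+1 :> nat then a j.+1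
    else 0.

Definition spectrum (R : realType) (m : nat) (H : 'M[R]_m) : set R[i] :=
  [set E | eigenvalue (map_mx (real_complex R) H) E].

Definition coef_convention (R : realType) (N : nat) (a b0 b1 : nat -> R) :
    Prop :=
  [/\ forall n, (1 <= n <= N - 2)%N -> a n < 0,
      [/\ a 0%N = -1, a (N - 1)%N = -1 & a N = -1]
    & b0 N = 0 /\ b1 N = 0].

Definition is_solution (K : nzRingType) (N : nat) (a b : nat -> K) (z : K)
    (u : nat -> K) : Prop :=
  forall n, (1 <= n <= N)%N ->
    a n * u n.+1 + b n * u n + a n.-1 * u n.-1 = z * u n.

Definition is_s_minus (K : nzRingType) (N : nat) (a b : nat -> K) (z : K)
    (u : nat -> K) : Prop :=
  [/\ is_solution N a b z u, u 0%N = 0 & u 1%N = 1].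

Definition is_s_plus (K : nzRingType) (N : nat) (a b : nat -> K) (z : K)
    (u : nat -> K) : Prop :=
  [/\ is_solution N a b z u, u N = 0 & u N.+1 = 1].

Definition wronskian (R : realType) (a u0 u1 : nat -> R) (n : nat) : R :=
  a n * (u0 n * u1 n.+1 - u0 n.+1 * u1 n).

(* c0 and c1 are the diagonals of the two difference equations
   a(n) u(n+1) + c_j(n) u(n) + a(n-1) u(n-1) = 0 solved by u0 and u1.  A
   solution for H_j at spectral parameter l is one for H_j - l at 0, with
   c_j = b_j - l (see [shift]).  For equal spectral parameters c0 - c1 is just
   b0 - b1; for different ones it is c0 - c1, not b0 - b1, whose sign governs
   the sign changes of W: W(n+1) - W(n) = (c0(n+1) - c1(n+1)) u0(n+1) u1(n+1). *)
Definition node_weight (R : realType) (a c0 c1 u0 u1 : nat -> R) (n : nat) :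
    int :=
  let W := wronskian a u0 u1 in
  if (0 < c0 n.+1 - c1 n.+1)
     && ((W n * W n.+1 < 0) || ((W n == 0) && (W n.+1 != 0))) then 1
  else if (c0 n.+1 - c1 n.+1 < 0)
     && ((W n * W n.+1 < 0) || ((W n != 0) && (W n.+1 == 0))) then -1
  else 0.

Definition weighted_nodes (R : realType) (N : nat) (a c0 c1 u0 u1 : nat -> R) :
    int :=
  \sum_(0 <= n < N) node_weight a c0 c1 u0 u1 n
  - (if wronskian a u0 u1 0 == 0 then 1 else 0).

Definition shift (R : realType) (b : nat -> R) (l : R) : nat -> R :=
  fun n => b n - l.

(* [fset_set] is meaningful only on finite sets: see [finite_spectrum].  The
   order of R[i] is partial: E < l%:C means that E is real and below l. *)
Definition num_below (R : realType) (m : nat) (H : 'M[R]_m) (l : R) : nat :=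
  #|` fset_set [set E | spectrum H E /\ E < l%:C]|%fset.

Definition num_below_or_eq (R : realType) (m : nat) (H : 'M[R]_m) (l : R) :
    nat :=
  #|` fset_set [set E | spectrum H E /\ E <= l%:C]|%fset.

Lemma finite_spectrum (R : realType) (m : nat) (H : 'M[R]_m) :
  finite_set (spectrum H).
Proof.
set A := map_mx (real_complex R) H.
have [s sP] := closed_field_poly_normal (char_poly A).
apply: (@sub_finite_set _ _ [set` s]); last exact: finite_seq.
move=> E /=; rewrite /spectrum /= -/A eigenvalue_root_char sP.
by rewrite (monicP (char_poly_monic A)) scale1r root_prod_XsubC.
Qed.

Lemma is_solution_shift (R : realType) (N : nat) (a b : nat -> R) (l : R)
    (u : nat -> R) :
  is_solution N a b l u <-> is_solution N a (shift b l) 0 u.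
Proof.
split=> h n /h; rewrite /shift mul0r => e.
  by rewrite -[RHS](subrr (l * u n)) -{1}e; ring.
by rewrite -[RHS]add0r -e; ring.
Qed.

Lemma s_minus_exists (K : fieldType) (N : nat) (a b : nat -> K) (z : K) :
  (forall n, (1 <= n <= N)%N -> a n != 0) ->
  exists u, is_s_minus N a b z u.
Proof.
move=> a0.
pose p := fix p n : K * K := if n is m.+1 then
  ((p m).2, ((z - b m.+1) * (p m).2 - a m * (p m).1) / a m.+1) else (0, 1).
exists (fun n => (p n).1); split=> // -[|n] // hn /=.
by rewrite [a n.+1 * _]mulrC mulfVK ?a0 //; ring.
Qed.

Lemma s_plus_exists (K : fieldType) (N : nat) (a b : nat -> K) (z : K) :
  (forall n, (n < N)%N -> a n != 0) ->
  exists u, is_s_plus N a b z u.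
Proof.
move=> a0.
(* p k = (u (N + 1 - k), u (N - k)) *)
pose p := fix p k : K * K := if k is m.+1 then
  ((p m).2, ((z - b (N - m)%N) * (p m).2 - a (N - m)%N * (p m).1)
            / a (N - m).-1) else (1, 0).
exists (fun n => (p (N.+1 - n)%N).1); split; last by rewrite subnn.
  move=> n /andP[n1 nN] /=.
  have [k kN ->] : exists2 k, (k < N)%N & n = (N - k)%N.
    by exists (N - n)%N; lia.
  have -> : (N.+1 - (N - k).+1 = k)%N by lia.
  have -> : (N.+1 - (N - k) = k.+1)%N by lia.
  have -> : (N.+1 - (N - k).-1 = k.+2)%N by lia.
  rewrite /= [a (N - k).-1 * _]mulrC mulfVK; last by apply: a0; lia.
  by ring.
by rewrite subSnn.
Qed.

(* Main.v *)
Require Import Defs.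
From HB Require Import structures.
From mathcomp Require Import all_boot all_order all_algebra.
From mathcomp Require Import reals.
From mathcomp Require Import polyrcf finmap complex boolp classical_sets cardinality.
From mathcomp Require Import zify ring lra.
Import Order.TTheory GRing.Theory Num.Theory.
Local Open Scope ring_scope.

(* A sequence u has a node at n if u(n) = 0 or u(n) u(n+1) < 0.  Comparing the
   slopes u(n+1)/u(n) and v(n+1)/v(n) (a zero of the denominator giving the
   slope -oo), let s(n) be 1 if v has the smaller one and 0 otherwise; s(n) can
   be read off the signs of W_n, u(n) and v(n).  In terms of Pruefer angles, the
   ceiling of (theta_v - theta_u)/pi is the node count of v minus that of u, plus
   s, and #_n is its increment: #_n = node_n(v) - node_n(u) + s(n+1) - s(n).
   Summing over n reduces # to the node counts of the two solutions.  For equal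
   operators all #_n vanish, and the same identity expresses the nodes of s_+ in
   terms of those of s_-.  Finally the nodes of s_-(l) count the eigenvalues
   below l: up to nonzero factors s_-(., n) is a Sturm sequence of monic
   polynomials with interlacing real roots. *)

Set Implicit Arguments.
Unset Strict Implicit.

(** * Real polynomials with interlacing roots *)

Section Interlacing.
Variable R : rcfType.

Lemma prod_XsubC_sign n (x : nat -> R) i y : (i <= n)%N ->
    (forall j, (j < i)%N -> x j < y) ->
    (forall j, (i <= j < n)%N -> y < x j) ->
  0 < (-1) ^+ (n - i) * \prod_(j < n) (y - x j).
Proof.
move=> + xy yx; elim: n yx => [|n IHn] yx.
  by rewrite leqn0 => /eqP->; rewrite big_ord0 mulr1.
rewrite leq_eqVlt => /predU1P[iE|ltin].
  rewrite iE subnn mul1r prodr_gt0 // => j _.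
  by rewrite subr_gt0 xy // iE.
rewrite big_ord_recr subSn //= exprS.
set s := _ ^+ _; set P := \prod_(_ < _) _.
have -> : -1 * s * (P * (y - x n)) = s * P * (x n - y) by ring.
rewrite mulr_gt0 //; last by rewrite subr_gt0 yx // -ltnS ltin ltnSn.
by apply: IHn => // j /andP[ij jn]; rewrite yx // ij ltnS ltnW.
Qed.

(** Reflection: $(-1)^n f(-X)$ is again monic, so its sign at plus infinity decides. *)
Lemma monic_sign_minfty n (f : {poly R}) : f \is monic -> size f = n.+1 ->
  exists M, forall y, y <= M -> 0 < (-1) ^+ n * f.[y].
Proof.
move=> fm fs; pose g := (-1) ^+ n *: (f \Po - 'X).
have lg : lead_coef g = 1.
  rewrite lead_coefZ lead_coef_comp ?size_polyN ?size_polyX // lead_coefN.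
  by rewrite lead_coefX (monicP fm) fs mul1r -exprMn mulrNN mulr1 expr1n.
have [|M gM] := @poly_pinfty_gt_lc _ g; first by rewrite lg.
exists (- M) => y yM; have := gM (- y); rewrite lerNr => /(_ yM).
rewrite lg /g hornerZ horner_comp hornerN hornerX opprK => ?.
exact: lt_le_trans ltr01 _.
Qed.

(** Intermediate values: the signs of [f] alternate along the [x i], and one more point on each side
    makes n+1 gaps, each with a root. The degree allows no others. *)
Lemma interlacing_roots n (x : nat -> R) (f : {poly R}) :
    f \is monic -> size f = n.+2 ->
    (forall i, (i.+1 < n)%N -> x i < x i.+1) ->
    (forall i, (i < n)%N -> 0 < (-1) ^+ (n - i) * f.[x i]) ->
  exists t : nat -> R, f = \prod_(i < n.+1) ('X - (t i)%:P)
    /\ forall i, (i < n)%N -> t i < x i < t i.+1.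
Proof.
move=> fm fs xlt fx.
have [hi fhi] : exists M, forall y, M <= y -> 0 < f.[y].
  have [|M fM] := @poly_pinfty_gt_lc _ f; first by rewrite (monicP fm).
  by exists M => y /fM; rewrite (monicP fm); apply: lt_le_trans.
have [lo flo] := monic_sign_minfty fm fs.
(* [xx] is [x] shifted by one between a far left and a far right point; [hi - 1] keeps the two
   points in order when n = 0. *)
pose xx i := if i is j.+1 then if (j < n)%N then x j else Num.max hi (x n.-1 + 1)
  else Num.min lo (if n is 0 then hi - 1 else x 0%N - 1).
have xx_lt i : (i <= n)%N -> xx i < xx i.+1.
  rewrite /xx; case: i => [_|j jn].
    case: (n) => [|m] /=; rewrite gt_min ?lt_max; apply/orP; right.
      by apply/orP; left; lra.
    by lra.
  rewrite jn; case: ltnP => [/xlt //|nj].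
  have -> : j = n.-1 by lia.
  by rewrite lt_max; apply/orP; right; lra.
have xx_sign i : (i <= n.+1)%N -> 0 < (-1) ^+ (n.+1 - i) * f.[xx i].
  rewrite /xx; case: i => [_|j jn]; first by rewrite subn0 flo // ge_min lexx.
  rewrite subSS; case: ltnP => [/fx //|nj].
  have -> : (n - j)%N = 0%N by lia.
  by rewrite mul1r fhi // le_max lexx.
have /choice[t tP] i : exists t, (i <= n)%N -> xx i < t < xx i.+1 /\ root f t.
  have [ltin|] := leqP i n; last by exists 0.
  have [|t] := @poly_ivtoo _ f _ _ (ltW (xx_lt i ltin)).
    have := mulr_gt0 (xx_sign i (leqW ltin)) (xx_sign i.+1 ltin).
    rewrite subSS subSn // exprS; set s := _ ^+ _.
    have -> : -1 * s * f.[xx i] * (s * f.[xx i.+1])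
      = - (s * s) * (f.[xx i] * f.[xx i.+1]) by ring.
    by rewrite /s -expr2 sqrr_sign mulN1r oppr_gt0.
  by rewrite in_itv /= => ? ?; exists t.
exists t; split=> [|i ltin]; last first.
  have [/andP[_ +] _] := tP _ (ltnW ltin); have [/andP[+ _] _] := tP _ ltin.
  by rewrite /= ltin => -> ->.
have sz : size f = (size (mkseq t n.+1)).+1 by rewrite size_mkseq.
rewrite {1}(all_roots_prod_XsubC sz) ?(monicP fm) ?scale1r.
- by rewrite big_map -(big_mkord xpredT (fun i => 'X - (t i)%:P)) /index_iota subn0.
- apply/allP => _ /mapP[i + ->]; rewrite mem_iota ltnS => /= lein.
  by have [] := tP i lein.
rewrite uniq_rootsE; apply: lt_sorted_uniq; apply/(sortedP 0) => i.
rewrite size_mkseq => lti; rewrite !nth_mkseq ?(ltnW lti) //.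
rewrite ltnS in lti.
have [/andP[_ ti] _] := tP i (ltnW lti); have [/andP[ti' _] _] := tP _ lti.
exact: lt_trans ti ti'.
Qed.

(** The counts differ by one exactly for [l] in $(t_i, x_i]$, unbounded above if i = n; there [F]
    and [G] agree in sign or [G] vanishes. *)
Lemma interlacing_count n (x t : nat -> R) (l : R) :
    (forall i, (i < n)%N -> t i < x i < t i.+1) ->
    let F := \prod_(i < n.+1) (l - t i) in let G := \prod_(i < n) (l - x i) in
  (\sum_(i < n.+1) (t i < l)%R = \sum_(i < n) (x i < l)%R
    + ((G == 0) || (0 < F * G))%R)%N.
Proof.
move=> xt /=.
(* Positivity beyond the last [t] is added for the induction: it gives the signs of the old products
   once [l] reaches [x n]. *)
suff [] : (t n < l -> 0 < \prod_(i < n.+1) (l - t i) /\ 0 < \prod_(i < n) (l - x i)) /\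
  (\sum_(i < n.+1) (t i < l)%R = \sum_(i < n) (x i < l)%R +
   ((\prod_(i < n) (l - x i) == 0) ||
    (0 < (\prod_(i < n.+1) (l - t i)) * \prod_(i < n) (l - x i)))%R)%N by [].
elim: n xt => [|n IHn] xt.
  by rewrite !big_ord1 !big_ord0 oner_eq0 mulr1 subr_gt0.
have [pos cnt] := IHn (fun i h => xt i (ltnW h)).
have /andP[tx xt'] := xt n (leqnn _).
rewrite !big_ord_recr /= in pos cnt *; rewrite {}cnt.
move: pos; set F := (\prod_(i < n) (l - t i) * (l - t n))%R.
set G := (\prod_(i < n) (l - x i))%R.
move=> pos; split=> [tl|].
  have xl := lt_trans xt' tl; have [F0 G0] := pos (lt_trans tx xl).
  by split; rewrite mulr_gt0 ?subr_gt0.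
have -> : F * (l - t n.+1) * (G * (l - x n))
   = ((l - t n.+1) * (l - x n)) * (F * G) by ring.
rewrite mulf_eq0 subr_eq0.
(* Left of [x n] both new factors are negative; right of it the sign of [l - t n.+1] decides; at
   [x n] the new [G] vanishes. *)
have [lx|xl|lx] := ltgtP l (x n).
- have lt' := lt_trans lx xt'.
  rewrite orbF addn0 (ltNge _ l) (ltW lt') addn0.
  have k0 : 0 < (l - t n.+1) * (l - x n) by rewrite nmulr_rgt0 subr_lt0.
  by rewrite (pmulr_rgt0 _ k0).
- have [F0 G0] := pos (lt_trans tx xl).
  have FG : 0 < F * G by rewrite mulr_gt0.
  by rewrite orbF (gt_eqF G0) FG (pmulr_lgt0 _ FG) pmulr_lgt0 ?subr_gt0.
have [F0 G0] := pos ltac:(by rewrite lx).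
by rewrite mulr_gt0 // orbT lx (ltNge _ (x n)) (ltW xt') !addn0.
Qed.

End Interlacing.

(** * The Sturm sequence of characteristic polynomials *)

(* jacobi_poly a b n.+1 is the characteristic polynomial of the leading n x n
   block; the index is that of s_-(z, n.+1), to which it is proportional. *)
Fixpoint jacobi_poly (K : nzRingType) (a b : nat -> K) (n : nat) : {poly K} :=
  if n is n1.+1 then
    if n1 is n2.+1 then
      ('X - (b n1)%:P) * jacobi_poly a b n1 - (a n2 ^+ 2) *: jacobi_poly a b n2
    else 1
  else 0.

Lemma jacobi_polySS (K : nzRingType) (a b : nat -> K) n :
  jacobi_poly a b n.+2 = ('X - (b n.+1)%:P) * jacobi_poly a b n.+1
     - (a n ^+ 2) *: jacobi_poly a b n.
Proof. by []. Qed.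

Lemma map_jacobi_poly (K L : nzRingType) (h : {rmorphism K -> L}) (a b : nat -> K) n :
  map_poly h (jacobi_poly a b n) = jacobi_poly (h \o a) (h \o b) n.
Proof.
suff [] : map_poly h (jacobi_poly a b n) = jacobi_poly (h \o a) (h \o b) n
  /\ map_poly h (jacobi_poly a b n.+1) = jacobi_poly (h \o a) (h \o b) n.+1 by [].
elim: n => [|n [IH0 IH1]]; first by rewrite rmorph0 rmorph1.
split=> //; rewrite !jacobi_polySS rmorphB rmorphM rmorphB /=.
by rewrite map_polyX map_polyC map_polyZ rmorphXn IH0 IH1.
Qed.

Lemma jacobi_poly_monic (K : idomainType) (a b : nat -> K) n :
  jacobi_poly a b n.+1 \is monic /\ size (jacobi_poly a b n.+1) = n.+1.
Proof.
suff [] : [/\ (size (jacobi_poly a b n) <= n)%N, jacobi_poly a b n.+1 \is monic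
  & size (jacobi_poly a b n.+1) = n.+1] by [].
elim: n => [|n [s0 m1 s1]]; first by rewrite size_poly0 monic1 size_poly1.
have mM : ('X - (b n.+1)%:P) * jacobi_poly a b n.+1 \is monic.
  by rewrite monicMl ?monicXsubC.
have sM : size (('X - (b n.+1)%:P) * jacobi_poly a b n.+1) = n.+2.
  by rewrite size_monicM ?monicXsubC ?monic_neq0 // size_XsubC s1.
have lt_s : (size (- (a n ^+ 2 *: jacobi_poly a b n))
    < size (('X - (b n.+1)%:P) * jacobi_poly a b n.+1)%R)%N.
  by rewrite size_polyN sM !ltnS (leq_trans (size_scale_leq _ _)) // (leq_trans s0).
split; [by rewrite s1|..]; rewrite jacobi_polySS; last by rewrite size_polyDl.
by rewrite monicE lead_coefDl // -monicE.
Qed.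

(** Sturm's argument: where [Q m.+1] vanishes, [Q m.+2] and [Q m] have opposite signs, so
    consecutive roots interlace and [interlacing_count] gives each term of the sum. *)
Lemma jacobi_poly_roots (R : rcfType) (a b : nat -> R) (m : nat) :
    (forall k, (0 < k < m)%N -> a k != 0) ->
  let Q := jacobi_poly a b in
  exists x : nat -> R,
    [/\ Q m.+1 = \prod_(i < m) ('X - (x i)%:P),
        forall i, (i.+1 < m)%N -> x i < x i.+1
      & forall l, (\sum_(i < m) (x i < l)%R = \sum_(1 <= k < m.+1)
          (((Q k).[l] == 0) || (0 < (Q k.+1).[l] * (Q k).[l]))%R)%N].
Proof.
move=> + Q.
(* The added third clause carries the induction: [m.-1 - i] roots of [Q m] lie above [x i]. *)
suff: (forall k, (0 < k < m)%N -> a k != 0) ->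
  exists x : nat -> R,
    [/\ Q m.+1 = \prod_(i < m) ('X - (x i)%:P),
        forall i, (i.+1 < m)%N -> x i < x i.+1,
        forall i, (i < m)%N -> 0 < (-1) ^+ (m.-1 - i) * (Q m).[x i]
      & forall l, (\sum_(i < m) (x i < l)%R = \sum_(1 <= k < m.+1)
          (((Q k).[l] == 0) || (0 < (Q k.+1).[l] * (Q k).[l]))%R)%N].
  by move=> h /h[x [? ? _ ?]]; exists x.
elim: m => [|m IHm] a0.
  by exists (fun=> 0); split=> // [|l]; rewrite ?big_ord0 ?big_geq.
have [|x [QE xlt Qx cnt]] := IHm; first by move=> k hk; apply: a0; lia.
have [Qm Qs] := jacobi_poly_monic a b m.+1.
have hor n (s : nat -> R) y :
    (\prod_(i < n) ('X - (s i)%:P)).[y] = \prod_(i < n) (y - s i).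
  by rewrite horner_prod; apply: eq_bigr => i _; rewrite hornerXsubC.
have [i im|t [QtE tx]] := interlacing_roots Qm Qs xlt.
  have rx : (Q m.+1).[x i] = 0.
    rewrite QE hor; apply/eqP/prodf_eq0.
    by exists (Ordinal im); rewrite //= subrr.
  (* Here $Q_{m+2} = -a(m)^2 Q_m$, and [a m] is nonzero since i < m forces m > 0. *)
  rewrite jacobi_polySS hornerD hornerM -/Q rx mulr0 add0r hornerN hornerZ -/Q.
  have -> : (m - i = (m.-1 - i).+1)%N by lia.
  rewrite exprS mulN1r mulrNN mulrCA mulr_gt0 ?Qx //.
  by rewrite exprn_even_gt0 //= a0 //; lia.
have tle d i : (i + d <= m)%N -> t i <= t (i + d)%N.
  elim: d => [|d IHd] h; first by rewrite addn0.
  have /andP[t1 t2] := tx (i + d)%N ltac:(lia).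
  rewrite addnS; apply: le_trans (IHd _) (ltW (lt_trans t1 t2)); lia.
exists t; split=> //.
- by move=> i /tx/andP[]; apply: lt_trans.
- move=> i im; rewrite QE hor; apply: prod_XsubC_sign => // j.
    move=> ji; have /andP[_ h] := tx j ltac:(lia); apply: lt_le_trans h _.
    by have := tle (i - j.+1)%N j.+1; rewrite subnKC //; apply; lia.
  case/andP=> ij jm; have /andP[h _] := tx j jm; apply: le_lt_trans h.
  by have := tle (j - i)%N i; rewrite subnKC //; apply; lia.
move=> l; rewrite big_nat_recr //= -cnt (interlacing_count l tx).
by rewrite [Q m.+2]QtE QE !hor.
Qed.

(** * The weight as an increment of node counts *)

Section WeightedNodes.
Variable R : realType.
Implicit Types a b c u v : nat -> R.

Definition is_node u n : bool := (u n == 0) || (u n * u n.+1 < 0).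

(* For a n < 0: u(n+1)/u(n) exceeds v(n+1)/v(n), where x/0 stands for -oo. *)
Definition wronskian_ahead a u v n : bool :=
  (0 < wronskian a u v n * (u n * v n)) || (v n == 0) && (u n != 0).

Lemma wronskian_step a c0 c1 u v n :
    a n.+1 * u n.+2 + c0 n.+1 * u n.+1 + a n * u n = 0 ->
    a n.+1 * v n.+2 + c1 n.+1 * v n.+1 + a n * v n = 0 ->
  wronskian a u v n.+1
    = wronskian a u v n + (c0 n.+1 - c1 n.+1) * (u n.+1 * v n.+1).
Proof.
move=> hu hv; rewrite /wronskian.
have eu : a n.+1 * u n.+2 = - (c0 n.+1 * u n.+1 + a n * u n).
  by apply/eqP; rewrite -addr_eq0 addrA hu.
have ev : a n.+1 * v n.+2 = - (c1 n.+1 * v n.+1 + a n * v n).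
  by apply/eqP; rewrite -addr_eq0 addrA hv.
have -> : a n.+1 * (u n.+1 * v n.+2 - u n.+2 * v n.+1)
    = u n.+1 * (a n.+1 * v n.+2) - (a n.+1 * u n.+2) * v n.+1 by ring.
by rewrite eu ev; ring.
Qed.

(** For nonzero [u n.+1] and [v n.+1], put $p = u(n)/u(n+1)$, $q = v(n)/v(n+1)$, $w = a(n)(p-q)$ and
    let d be the difference of the diagonals. Up to the factor $u(n+1)v(n+1)$, $W_n$ and $W_{n+1}$
    are w and w+d, which leaves a check of signs. *)
Lemma node_weightE a c0 c1 u v n : a n < 0 ->
    a n.+1 * u n.+2 + c0 n.+1 * u n.+1 + a n * u n = 0 ->
    a n.+1 * v n.+2 + c1 n.+1 * v n.+1 + a n * v n = 0 ->
    (u n != 0) || (u n.+1 != 0) -> (v n != 0) || (v n.+1 != 0) ->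
  node_weight a c0 c1 u v n
    = (is_node v n)%:Z - (is_node u n)%:Z
      + (wronskian_ahead a u v n.+1)%:Z - (wronskian_ahead a u v n)%:Z.
Proof.
move=> an hu hv nzu nzv; have := wronskian_step hu hv.
rewrite /node_weight /wronskian_ahead /is_node.
move: (erefl (wronskian a u v n)); rewrite {2}/wronskian.
move: (wronskian a u v n) (wronskian a u v n.+1) {hu hv} => W W'.
move: (u n) (u n.+1) (v n) (v n.+1) (a n) (c0 n.+1 - c1 n.+1) an nzu nzv.
move=> x x1 y y1 e d e0 nzx nzy WE W'E.
have WW : (W * W < 0) = false by rewrite ltNge -expr2 sqr_ge0.
(* If [u n.+1] is zero, W is unchanged, the weight is 0, and [wronskian_ahead] at n says whether v
   has a node. *)
have [x10|x1n0] := eqVneq x1 0.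
  rewrite x10 in nzx W'E WE *; rewrite eqxx orbF in nzx.
  have -> : W' = W by rewrite W'E; ring.
  rewrite WW andbN andNb orbF !andbF /=.
  rewrite mul0r !mulr0 ltxx (negbTE nzx) /= andbT.
  have -> : W * (x * y) = e * x ^+ 2 * (y * y1) by rewrite WE; ring.
  rewrite nmulr_rgt0; last by rewrite pmulr_llt0 // exprn_even_gt0.
  by rewrite orbC; case: (_ || _).
(* If only [v n.+1] is zero, W is again unchanged; [wronskian_ahead] holds at n+1, and at n exactly
   when u has no node. *)
have [y10|y1n0] := eqVneq y1 0.
  rewrite y10 in nzy W'E WE *; rewrite eqxx orbF in nzy.
  have -> : W' = W by rewrite W'E; ring.
  rewrite WW andbN andNb orbF !andbF /=.
  rewrite !mulr0 ltxx (negbTE nzy) /= orbF.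
  have -> : W * (x * y) = (- e) * y ^+ 2 * (x * x1) by rewrite WE; ring.
  rewrite pmulr_rgt0; last by rewrite pmulr_lgt0 ?oppr_gt0 // exprn_even_gt0.
  have [->|xn0] := eqVneq x 0; first by rewrite mul0r ltxx.
  have := mulf_neq0 xn0 x1n0; by case: ltgtP.
have [p pE] : exists p, x = p * x1 by exists (x / x1); rewrite divfK.
have [q qE] : exists q, y = q * y1 by exists (y / y1); rewrite divfK.
have [w wdef] : exists w, w = e * (p - q) by exists (e * (p - q)).
have k2 : 0 < (x1 * y1) ^+ 2 by rewrite exprn_even_gt0 ?mulf_neq0.
have x2 : 0 < x1 ^+ 2 by rewrite exprn_even_gt0.
have y2 : 0 < y1 ^+ 2 by rewrite exprn_even_gt0.
have {}WE : W = x1 * y1 * w by rewrite WE wdef pE qE; ring.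
have {}W'E : W' = x1 * y1 * (w + d) by rewrite W'E WE; ring.
have -> : W * W' = (x1 * y1) ^+ 2 * (w * (w + d)) by rewrite W'E WE; ring.
have -> : W * (x * y) = (x1 * y1) ^+ 2 * (w * (p * q)) by rewrite WE pE qE; ring.
have -> : W' * (x1 * y1) = (x1 * y1) ^+ 2 * (w + d) by rewrite W'E; ring.
have -> : x * x1 = x1 ^+ 2 * p by rewrite pE; ring.
have -> : y * y1 = y1 ^+ 2 * q by rewrite qE; ring.
rewrite W'E WE pE qE !(mulf_eq0, negb_or) (negbTE x1n0) (negbTE y1n0) /= !orbF.
rewrite !(pmulr_rgt0 _ k2) (pmulr_rlt0 _ k2) (pmulr_rlt0 _ x2) (pmulr_rlt0 _ y2).
have wE : (0 < w) = (p < q) by rewrite wdef nmulr_rgt0 // subr_lt0.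
(* The asymmetric rule for zeros of W amounts to counting w = 0 with the negative values. *)
have weight : (if (0 < d) && ((w * (w + d) < 0) || (w == 0) && (w + d != 0)) then 1
   else if (d < 0) && ((w * (w + d) < 0) || (w != 0) && (w + d == 0)) then -1
   else 0) = (0 < w + d)%R%:Z - (0 < w)%R%:Z.
  case: (ltgtP 0 w) => [w0|w0|<-];
    rewrite ?(pmulr_rlt0 _ w0) ?(nmulr_rlt0 _ w0) ?mul0r ?add0r ?ltxx;
    case: (ltgtP 0 d) => d0; case: (ltgtP 0 (w + d)) => wd //=; exfalso; lra.
rewrite weight wE andbT.
(* The nodes of u and v are now $p \le 0$ and $q \le 0$; the order of p and q fixes the sign of
   w. *)
have [pq|qp] := ltP p q.
  have w0 : 0 < w by rewrite wE.
  rewrite pmulr_rgt0 //.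
  case: (ltgtP 0 p) pq => [p0|p0|<-]; rewrite ?(pmulr_rgt0 _ p0) ?(nmulr_rgt0 _ p0) ?mul0r;
    case: (ltgtP 0 q) => q0 pq //=; try (exfalso; lra); by rewrite ?ltxx /=; case: (0 < w + d).
have w0 : w <= 0 by rewrite leNgt wE -leNgt.
have [->|pq] := eqVneq p q.
  have -> : (0 < w * (q * q)) = false.
    by rewrite ltNge; apply/negbF; rewrite mulr_le0_ge0 // -expr2 sqr_ge0.
  by rewrite andbN; case: (_ || _); case: (0 < _).
have {}w0 : w < 0.
  rewrite lt_neqAle w0 wdef mulf_neq0 ?subr_eq0 //; lra.
have {}qp : q < p by rewrite lt_neqAle eq_sym pq.
rewrite nmulr_rgt0 //.
case: (ltgtP 0 p) qp => [p0|p0|<-]; rewrite ?(pmulr_rlt0 _ p0) ?(nmulr_rlt0 _ p0) ?mul0r;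
    case: (ltgtP 0 q) => q0 qp //=; try (exfalso; lra);
      by rewrite ?ltxx /=; case: (0 < w + d).
Qed.
End WeightedNodes.

(** * Eigenvalues through the value of [s_-] at N *)

(** The product of the [a k] clears the divisions in the recurrence. The second equation is the
    first at the preceding index times [a n], in a form that includes n = 0. *)
Lemma jacobi_poly_solution (K : comNzRingType) (N : nat) (a b : nat -> K) (z : K)
    (u : nat -> K) : is_s_minus N a b z u -> forall n, (n <= N)%N ->
  (jacobi_poly a b n.+1).[z] = u n.+1 * \prod_(1 <= k < n.+1) a k
  /\ a n * (jacobi_poly a b n).[z] = u n * \prod_(1 <= k < n.+1) a k.
Proof.
move=> [sol u0 u1]; elim=> [_|n IHn nN].
  by rewrite big_geq // u0 u1 hornerE horner0 mulr1 mulr0 mul0r.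
have [Q1 Q0] := IHn (ltnW nN); have rec := sol n.+1 nN.
rewrite big_nat_recr //=; split; last by rewrite Q1; ring.
rewrite -/(jacobi_poly a b n.+2) jacobi_polySS hornerD hornerM hornerN hornerZ.
rewrite hornerXsubC Q1 expr2 -mulrA Q0.
have -> : u n.+2 * (\prod_(1 <= k < n.+1) a k * a n.+1)
  = (a n.+1 * u n.+2 + b n.+1 * u n.+1 + a n * u n - b n.+1 * u n.+1 - a n * u n)
    * \prod_(1 <= k < n.+1) a k by ring.
by rewrite rec; ring.
Qed.

(** The zeros at 0 and [m.+1] replace the neighbours missing in the first and last columns. *)
Lemma mul_jacobi_matrix (K : comNzRingType) (m : nat) (a b w : nat -> K) (j : 'I_m) :
    w 0%N = 0 -> w m.+1 = 0 ->
  \sum_(i < m) w i.+1 * jacobi_matrix m.+1 a b i j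
    = a j.+1 * w j.+2 + b j.+1 * w j.+1 + a j * w j.
Proof.
move=> w0 wm.
have pick (F : nat -> K) k :
    \sum_(i < m) F i * (i == k :> nat)%:R = if (k < m)%N then F k else 0.
  case: ltnP => [km|mk].
    rewrite (bigD1 (Ordinal km)) //= eqxx mulr1 big1 ?addr0 // => i /negbTE.
    by rewrite -val_eqE /= => ->; rewrite mulr0.
  by rewrite big1 // => i _; rewrite ltn_eqF ?mulr0 // (leq_trans _ mk).
transitivity (\sum_(i < m) (w i.+1 * a j.+1 * (i == j.+1 :> nat)%:R
   + w i.+1 * b j.+1 * (i == j :> nat)%:R + w i.+1 * a i.+1 * (i.+1 == j :> nat)%:R)).
  apply: eq_bigr => i _; rewrite mxE (eq_sym (val j)).
  case: (ltngtP i j) => [ij|ji|->].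
  - rewrite (ltn_eqF (leqW ij)) eq_sym; case: eqP => _; rewrite ?mulr0 ?mulr1; ring.
  - rewrite (gtn_eqF (leqW ji)) ; case: eqP => _; rewrite ?mulr0 ?mulr1; ring.
  - by rewrite (gtn_eqF (ltnSn _)) (ltn_eqF (ltnSn _)) !mulr0 mulr1 add0r addr0.
rewrite !big_split /= (pick (fun i => w i.+1 * a j.+1)) (pick (fun i => w i.+1 * b j.+1)).
rewrite ltn_ord; congr (_ + _ + _); last 1 first.
- case: j => [[|j] jm] /=; first by rewrite big1 ?w0 ?mulr0 // => i _; rewrite mulr0.
  under eq_bigr do rewrite eqSS.
  by rewrite (pick (fun i => w i.+1 * a i.+1)) (ltnW jm) mulrC.
- case: ltnP => [_|mj]; first by rewrite mulrC.
  have -> : j.+2 = m.+1 by move: (ltn_ord j); lia.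
  by rewrite wm mulr0.
- by rewrite mulrC.
Qed.

(** An eigenvector padded by zeros at 0 and N solves the recurrence, hence is a multiple of [u];
    conversely, [u] restricts to an eigenvector when [u N] vanishes. *)
Lemma eigenvalue_jacobi_matrix (K : fieldType) (N : nat) (a b : nat -> K) (z : K)
    (u : nat -> K) :
    (2 <= N)%N -> (forall n, (0 < n < N)%N -> a n != 0) -> is_s_minus N a b z u ->
  eigenvalue (jacobi_matrix N a b) z = (u N == 0).
Proof.
case: N => [|[|m]] // _ a0 [sol u0 u1]; apply/eigenvalueP/eqP => [[v vA v0]|uN].
  pose w n := if n is k.+1 then (if insub k is Some i then v 0 i else 0) else 0.
  have wE (i : 'I_m.+1) : w i.+1 = v 0 i by rewrite /= valK.
  have wN : w m.+2 = 0 by rewrite /= insubF ?ltnn.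
  have rec n : (n < m.+1)%N -> a n.+1 * w n.+2 + b n.+1 * w n.+1 + a n * w n = z * w n.+1.
    move=> nm; pose j := Ordinal nm.
    rewrite -(@mul_jacobi_matrix _ _ a b w j) // (wE j).
    have := congr1 (fun r : 'rV_m.+1 => r 0 j) vA; rewrite !mxE => <-.
    by apply: eq_bigr => i _; rewrite wE.
  (* Uniqueness: the values at 0 and 1 determine the rest, as [a n.+1] can be cancelled. *)
  have wu n : (n <= m.+2)%N -> w n = w 1%N * u n.
    move=> nm; suff [] : w n = w 1%N * u n /\ ((n < m.+2)%N -> w n.+1 = w 1%N * u n.+1) by [].
    elim: n nm => [|n IHn] nm; first by rewrite u0 u1 mulr0 mulr1.
    have [IH0 /(_ nm) IH1] := IHn (ltnW nm); split=> // nm'.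
    apply: (mulfI (a0 n.+1 nm')).
    have e1 := rec n nm'; have e2 := sol n.+1 (ltnW nm').
    have -> : a n.+1 * w n.+2 = z * w n.+1 - b n.+1 * w n.+1 - a n * w n.
      by rewrite -e1; ring.
    have -> : a n.+1 * (w 1%N * u n.+2)
      = w 1%N * (a n.+1 * u n.+2 + b n.+1 * u n.+1 + a n * u n - b n.+1 * u n.+1 - a n * u n).
      by ring.
    by rewrite e2 IH1 IH0; ring.
  have w1 : w 1%N != 0.
    apply: contraNneq v0 => w10; apply/eqP/rowP => i.
    by rewrite mxE -wE (wu _ (leqW (ltn_ord i))) w10 mul0r.
  by have := wu _ (leqnn _); rewrite wN => /esym/eqP; rewrite mulf_eq0 (negbTE w1) => /eqP.
exists (\row_i u i.+1); last first.
  by apply/eqP => /rowP/(_ ord0); rewrite !mxE u1 => /eqP; rewrite oner_eq0.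
apply/rowP => j; rewrite !mxE -(sol j.+1); last by move: (ltn_ord j); lia.
rewrite -mul_jacobi_matrix //; by apply: eq_bigr => i _; rewrite mxE.
Qed.

(** * Counting eigenvalues by nodes of [s_-] *)

Section Spectrum.
Variables (R : realType) (N : nat) (a b : nat -> R).
Hypothesis N2 : (2 <= N)%N.
Hypothesis a_lt0 : forall n, (n <= N)%N -> a n < 0.
Local Notation H := (jacobi_matrix N a b).

(** [s] lists the roots of [jacobi_poly a b N]; it splits over the reals, so they exhaust the
    complex spectrum. *)
Lemma jacobi_spectrum : exists s : seq R,
  [/\ uniq s, spectrum H = [set` [seq x%:C%C | x <- s]]%classic
    & forall l u, is_s_minus N a b l u ->
        (l \in s) = (u N == 0)
        /\ count (fun x => x < l) s = (\sum_(1 <= k < N) is_node u k)%N].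
Proof.
have a0 k : (k <= N)%N -> a k != 0 by move=> /a_lt0/lt_eqF->.
have [|x [QE xlt cnt]] := @jacobi_poly_roots _ a b N.-1.
  by move=> k hk; apply: a0; lia.
have N1 : N.-1.+1 = N by lia.
rewrite N1 in QE cnt; pose s := mkseq x N.-1.
have {}QE : jacobi_poly a b N = \prod_(y <- s) ('X - y%:P).
  by rewrite QE big_map -(big_mkord xpredT (fun i => 'X - (x i)%:P)) /index_iota subn0.
have us : uniq s.
  apply: lt_sorted_uniq; apply/(sortedP 0) => i.
  by rewrite size_mkseq => lti; rewrite !nth_mkseq ?(ltnW lti) // xlt.
(* Used with the identity for real [l] and with [real_complex] for complex eigenvalues. *)
have solE (K : fieldType) (h : {rmorphism R -> K}) z w : is_s_minus N (h \o a) (h \o b) z w ->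
    (w N == 0) = (z \in map h s).
  move=> hw; have [] := jacobi_poly_solution hw (leq_pred _).
  rewrite N1 -map_jacobi_poly QE rmorph_prod => e _.
  rewrite -[in RHS](root_prod_XsubC (map h s)) big_map /root.
  under eq_bigr do rewrite -map_polyXsubC.
  rewrite e mulf_eq0 [X in _ || X]negbTE ?orbF // prodf_seq_neq0.
  by apply/allP => k; rewrite mem_index_iota /= fmorph_eq0 => hk; apply: a0; lia.
exists s; split=> // [|l u hu]; last first.
  split; first by rewrite (solE _ idfun _ _ hu) map_id.
  transitivity (\sum_(i < N.-1) (x i < l)%R)%N.
    rewrite -sum1_count big_map big_mkcond.
    by rewrite -(big_mkord xpredT (fun i => (x i < l)%R : nat)) /index_iota subn0.
  rewrite cnt; apply: eq_big_nat => -[|n] // /andP[_ nN].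
  have [Q1 _] := jacobi_poly_solution hu (ltnW (ltnW nN)).
  have [Q2 _] := jacobi_poly_solution hu (ltnW nN).
  rewrite big_nat_recr //= in Q2; rewrite Q1 Q2 /is_node.
  set P := \prod_(_ <= _ < _) _.
  have P0 : P != 0.
    rewrite prodf_seq_neq0; apply/allP => k.
    by rewrite mem_index_iota /= => hk; apply: a0; lia.
  rewrite mulf_eq0 (negbTE P0) orbF.
  (* As [a n.+1] is negative, the polynomials agree in sign exactly where [u] changes sign. *)
  have -> : u n.+2 * (P * a n.+1) * (u n.+1 * P) = P ^+ 2 * (- a n.+1) * (- (u n.+1 * u n.+2)).
    by ring.
  rewrite pmulr_rgt0 ?oppr_gt0 // mulr_gt0 ?exprn_even_gt0 // oppr_gt0.
  exact: a_lt0 (ltnW nN).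
suff HE E : eigenvalue (map_mx (real_complex R) H) E = (E \in [seq x%:C%C | x <- s]).
  by apply/seteqP; split=> E /=; rewrite /spectrum /= HE.
have -> : map_mx (real_complex R) H
    = jacobi_matrix N (real_complex R \o a) (real_complex R \o b).
  apply/matrixP => i j; rewrite !mxE.
  by do ![case: ifP => _ //]; rewrite rmorph0.
have ca0 k : (k <= N)%N -> (real_complex R \o a) k != 0 by move=> kN; rewrite /= fmorph_eq0 a0.
have [w hw] := @s_minus_exists _ N (real_complex R \o a) (real_complex R \o b) E
  (fun n h => ca0 n (proj2 (andP h))).
rewrite (eigenvalue_jacobi_matrix N2 _ hw) ?(solE _ _ _ _ hw) //.
by move=> n /andP[_ /ltnW]; apply: ca0.
Qed.

(** On real eigenvalues the order of [R[i]] is that of R, so both cardinalities are counts in the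
    duplicate-free list [s]; the last term records whether [l] is in it. *)
Lemma num_below_jacobi l u : is_s_minus N a b l u ->
  num_below H l = (\sum_(1 <= k < N) is_node u k)%N
  /\ num_below_or_eq H l = (\sum_(1 <= k < N) is_node u k + (u N == 0)%R)%N.
Proof.
move=> hu; have [s [us HE /(_ _ _ hu)[<- <-]]] := jacobi_spectrum.
have card (p : pred R[i]) : #|` fset_set [set E | spectrum H E /\ p E]|%fset
    = count (fun x => p x%:C%C) s.
  have -> : [set E | spectrum H E /\ p E]%classic
      = [set` [fset E in [seq E <- [seq x%:C%C | x <- s] | p E]]%fset]%classic.
    rewrite HE; apply/seteqP; split=> E /=; rewrite !inE mem_filter.
      by case=> -> ->.
    by case/andP.
  rewrite set_fsetK card_fseq undup_id ?size_filter ?count_map //.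
  by rewrite filter_uniq // map_inj_uniq //; exact: complexI.
split; first by rewrite /num_below card; apply: eq_count => x; rewrite ltcR.
rewrite /num_below_or_eq card -count_uniq_mem //.
elim: (s) => //= x t ->; rewrite lecR le_eqVlt eq_sym.
case: ltgtP => _ /=; lia.
Qed.
End Spectrum.

(** * Comparing the nodes of two solutions *)

Lemma coef_convention_lt0 (R : realType) (N : nat) (a b0 b1 : nat -> R) :
  coef_convention N a b0 b1 -> forall n, (n <= N)%N -> a n < 0.
Proof.
move=> [an [a0 aN1 aN] _] n nN; have [->|n0] := eqVneq n 0%N; first by rewrite a0 ltrN10.
have [->|nN0] := eqVneq n N; first by rewrite aN ltrN10.
have [->|nN1] := eqVneq n (N - 1)%N; first by rewrite aN1 ltrN10.
by apply: an; lia.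
Qed.

Section Comparison.
Variables (R : realType) (N : nat) (a : nat -> R).
Hypothesis a_lt0 : forall n, (n <= N)%N -> a n < 0.

Lemma solution_recurrence b l u n : is_solution N a b l u -> (n < N)%N ->
  a n.+1 * u n.+2 + shift b l n.+1 * u n.+1 + a n * u n = 0.
Proof. by move=> /is_solution_shift sol nN; rewrite (sol n.+1 nN) mul0r. Qed.

(** As [a] never vanishes, the recurrence runs both ways and spreads two consecutive zeros
    everywhere. *)
Lemma solution_neq0 b l u k n : is_solution N a b l u -> (k <= N)%N -> (n <= N)%N ->
  (u k != 0) || (u k.+1 != 0) -> (u n != 0) || (u n.+1 != 0).
Proof.
move=> sol; have an0 i : (i <= N)%N -> a i != 0 by move=> /a_lt0/lt_eqF->.
suff iff0 i : (i <= N)%N ->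
    (u i != 0) || (u i.+1 != 0) = (u 0%N != 0) || (u 1%N != 0).
  by move=> kN nN; rewrite !iff0.
elim: i => // i IHi iN; rewrite -IHi ?(ltnW iN) //.
apply: negb_inj; rewrite !negb_or !negbK.
have rec := solution_recurrence sol iN.
rewrite andbC; apply/andP/andP => -[/eqP u0 /eqP u1]; split; apply/eqP => //.
  move: rec; rewrite u0 u1 !mulr0 !add0r => /eqP.
  by rewrite mulf_eq0 (negbTE (an0 _ (ltnW iN))) => /eqP.
move: rec; rewrite u0 u1 !mulr0 !addr0 => /eqP.
by rewrite mulf_eq0 (negbTE (an0 _ iN)) => /eqP.
Qed.

Lemma sum_node_weight b0 b1 l0 l1 u v :
    is_solution N a b0 l0 u -> is_solution N a b1 l1 v ->
    (forall n, (n <= N)%N -> (u n != 0) || (u n.+1 != 0)) ->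
    (forall n, (n <= N)%N -> (v n != 0) || (v n.+1 != 0)) ->
  \sum_(0 <= n < N) node_weight a (shift b0 l0) (shift b1 l1) u v n
    = (\sum_(0 <= n < N) is_node v n)%N%:Z - (\sum_(0 <= n < N) is_node u n)%N%:Z
      + (wronskian_ahead a u v N)%:Z - (wronskian_ahead a u v 0)%:Z.
Proof.
move=> su sv u0 v0.
(* N also bounds the hypotheses, so the telescoping induction runs on M. *)
suff h M : (M <= N)%N -> \sum_(0 <= n < M) node_weight a (shift b0 l0) (shift b1 l1) u v n
    = (\sum_(0 <= n < M) is_node v n)%N%:Z - (\sum_(0 <= n < M) is_node u n)%N%:Z
      + (wronskian_ahead a u v M)%:Z - (wronskian_ahead a u v 0)%:Z by exact: h.
elim: M => [|M IHM] MN; first by rewrite !big_geq // addrK subrr.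
rewrite !big_nat_recr //= IHM ?(ltnW MN) // !PoszD.
rewrite (node_weightE (a_lt0 (ltnW MN))
  (solution_recurrence su MN) (solution_recurrence sv MN)
  (u0 _ (ltnW MN)) (v0 _ (ltnW MN))).
by ring.
Qed.

Lemma s_minus_neq0 b l u : is_s_minus N a b l u -> forall n, (n <= N)%N ->
  (u n != 0) || (u n.+1 != 0).
Proof.
move=> [sol _ u1] n nN; apply: (solution_neq0 sol (leq0n N) nN).
by rewrite u1 oner_eq0 orbT.
Qed.

Lemma s_plus_neq0 b l u : is_s_plus N a b l u -> forall n, (n <= N)%N ->
  (u n != 0) || (u n.+1 != 0).
Proof.
move=> [sol _ u1] n nN; apply: (solution_neq0 sol (leqnn N) nN).
by rewrite u1 oner_eq0 orbT.
Qed.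

Lemma s_minus_nodes b l u : (0 < N)%N -> is_s_minus N a b l u ->
  (\sum_(0 <= n < N) is_node u n = (\sum_(1 <= n < N) is_node u n).+1)%N.
Proof. by move=> N0 [_ u0 _]; rewrite big_ltn // /is_node u0 eqxx. Qed.

(* The Wronskian of the two solutions for the same operator is constant and has
   no weighted node, so the comparison of nodes has only boundary terms. *)
Lemma s_plus_nodes b l u v : (0 < N)%N -> is_s_minus N a b l u -> is_s_plus N a b l v ->
  (v 0%N == 0) = (u N == 0)
  /\ (\sum_(0 <= n < N) is_node v n
       = \sum_(1 <= n < N) is_node u n + (u N == 0)%R)%N.
Proof.
move=> N0 hu hv; have [su u0 u1] := hu; have [sv vN vN1] := hv.
split.
  have cst n : (n <= N)%N -> wronskian a u v n = wronskian a u v 0.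
    elim: n => // n IHn nN; rewrite -IHn ?(ltnW nN) //.
    rewrite (wronskian_step (solution_recurrence su nN) (solution_recurrence sv nN)).
    by rewrite subrr mul0r addr0.
  (* The end values are $W_N = a(N)u(N)$ and $W_0 = -a(0)v(0)$. *)
  have := cst N (leqnn N); rewrite /wronskian u0 u1 vN vN1 mul0r mulr0 mulr1 mul1r.
  rewrite subr0 sub0r mulrN => e.
  have aN := lt_eqF (a_lt0 (leqnn N)); have a0 := lt_eqF (a_lt0 (leq0n N)).
  have := congr1 (fun r => r == 0) e.
  by rewrite oppr_eq0 !mulf_eq0 aN a0.
have := sum_node_weight su sv (s_minus_neq0 hu) (s_plus_neq0 hv).
rewrite big1 => [|n _]; last by rewrite /node_weight subrr ltxx.
(* [wronskian_ahead] is false at 0, and at N it says that [u N] is nonzero. *)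
rewrite (s_minus_nodes N0 hu) /wronskian_ahead u0 vN eqxx.
rewrite mul0r !mulr0 ltxx /= andbF.
by case: (u N == 0) => /=; lia.
Qed.
End Comparison.

Unset Implicit Arguments.

Theorem theorem1p2 (R : realType) (N : nat) (a b0 b1 : nat -> R)
    (hN : (2 <= N)%N) (hcoef : coef_convention N a b0 b1)
    (lam0 lam1 : R) (s0m s0p s1m s1p : nat -> R)
    (hs0m : is_s_minus N a b0 lam0 s0m) (hs0p : is_s_plus N a b0 lam0 s0p)
    (hs1m : is_s_minus N a b1 lam1 s1m) (hs1p : is_s_plus N a b1 lam1 s1p) :
  weighted_nodes N a (shift b0 lam0) (shift b1 lam1) s0m s1p
    = weighted_nodes N a (shift b0 lam0) (shift b1 lam1) s0p s1m
  /\ weighted_nodes N a (shift b0 lam0) (shift b1 lam1) s0p s1m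
    = (num_below (jacobi_matrix N a b1) lam1)%:Z
      - (num_below_or_eq (jacobi_matrix N a b0) lam0)%:Z.
Proof.
have a_lt0 := coef_convention_lt0 hcoef; have N0 := ltnW hN.
have [sol0m u0 u1] := hs0m; have [sol0p uN uN1] := hs0p.
have [sol1m v0 v1] := hs1m; have [sol1p vN vN1] := hs1p.
have [_ ->] := num_below_jacobi hN a_lt0 hs0m.
have [-> _] := num_below_jacobi hN a_lt0 hs1m.
have [z0 cnt0] := s_plus_nodes a_lt0 N0 hs0m hs0p.
have [z1 cnt1] := s_plus_nodes a_lt0 N0 hs1m hs1p.
have a0n0 := lt_eqF (a_lt0 _ (leq0n N)).
have nz0m := s_minus_neq0 a_lt0 hs0m; have nz0p := s_plus_neq0 a_lt0 hs0p.
have nz1m := s_minus_neq0 a_lt0 hs1m; have nz1p := s_plus_neq0 a_lt0 hs1p.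
rewrite /weighted_nodes (sum_node_weight a_lt0 sol0m sol1p nz0m nz1p).
rewrite (sum_node_weight a_lt0 sol0p sol1m nz0p nz1m).
rewrite cnt0 cnt1 (s_minus_nodes N0 hs0m) (s_minus_nodes N0 hs1m).
(* For [s0m], [s1p] the only boundary term is at N, namely whether [s0m N] is nonzero; for [s0p],
   [s1m] it is at 0, with [s0p 0]. *)
rewrite /wronskian_ahead u0 vN uN v0 !eqxx !(mul0r, mulr0) !ltxx /= andbF.
rewrite /wronskian u0 u1 v0 v1 !(mul0r, mulr0, mul1r, mulr1) sub0r !subr0.
rewrite !mulf_eq0 oppr_eq0 a0n0 /= z0 z1.
(* The correction for $W_0 = 0$ cancels the extra node of [s1p] in the first case; in the second it
   supplies the term for the eigenvalue [lam0]. *)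
by case: (s0m N == 0); case: (s1m N == 0) => /=; split; lia.
Qed.
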